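(* Let $(\mathfrak g,\mathfrak h,\rho,\psi)$ be a matched pair of 3-Lie algebras over a field $\mathbf k$. Then there is a bijection $$\{\text{infinitesimal deformations of }(\mathfrak g,\mathfrak h,\rho,\psi)\}/\!\sim\ \longleftrightarrow\ H^2_{\mathrm{MPL}}(\mathfrak g,\mathfrak h,\rho,\psi)$$ between the set of equivalence classes of infinitesimal deformations and the second cohomology group of the matched pair (with coefficients in itself).
   Context: A 3-Lie algebra (over a commutative ring) is a module $\mathfrak g$ with an alternating trilinear bracket satisfying $[x_1,x_2,[y_1,y_2,y_3]]=[[x_1,x_2,y_1],y_2,y_3]+[y_1,[x_1,x_2,y_2],y_3]+[y_1,y_2,[x_1,x_2,y_3]]$. A matched pair of 3-Lie algebras is a quadruple $(\mathfrak g,\mathfrak h,\rho,\psi)$ with $\mathfrak g,\mathfrak h$ 3-Lie algebras and trilinear maps $\rho:\mathfrak g\times\mathfrak g\times\mathfrak h\to\mathfrak h$, $\psi:\mathfrak h\times\mathfrak h\times\mathfrak g\to\mathfrak g$, alternating in the first two arguments, such that for all $x_i\in\mathfrak g$, $a_i\in\mathfrak h$: (M1) $\psi(a_1,a_2)[x_1,x_2,x_3]=[\psi(a_1,a_2)x_1,x_2,x_3]+[x_1,\psi(a_1,a_2)x_2,x_3]+[x_1,x_2,\psi(a_1,a_2)x_3]$; (M2) $-\psi(\rho(x_1,x_2)a_1,a_2)x_3=-\psi(\rho(x_1,x_3)a_2,a_1)x_2+\psi(\rho(x_2,x_3)a_2,a_1)x_1-[x_1,x_2,\psi(a_1,a_2)x_3]$;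 (M3) $[\psi(a_1,a_2)x_1,x_2,x_3]=\psi(a_1,a_2)[x_1,x_2,x_3]+\psi(\rho(x_2,x_3)a_1,a_2)x_1+\psi(a_1,\rho(x_2,x_3)a_2)x_1$; (M4) $\rho(x_1,x_2)[a_1,a_2,a_3]=[\rho(x_1,x_2)a_1,a_2,a_3]+[a_1,\rho(x_1,x_2)a_2,a_3]+[a_1,a_2,\rho(x_1,x_2)a_3]$; (M5) $-\rho(\psi(a_1,a_2)x_1,x_2)a_3=-\rho(\psi(a_1,a_3)x_2,x_1)a_2+\rho(\psi(a_2,a_3)x_2,x_1)a_1-[a_1,a_2,\rho(x_1,x_2)a_3]$; (M6) $[\rho(x_1,x_2)a_1,a_2,a_3]=\rho(x_1,x_2)[a_1,a_2,a_3]+\rho(\psi(a_2,a_3)x_1,x_2)a_1+\rho(x_1,\psi(a_2,a_3)x_2)a_1$. A morphism $(\mathfrak g,\mathfrak h,\rho,\psi)\to(\mathfrak g',\mathfrak h',\rho',\psi')$ is a pair of 3-Lie algebra homomorphisms $f:\mathfrak g\to\mathfrak g'$, $g:\mathfrak h\to\mathfrak h'$ with $g(\rho(x_1,x_2)a)=\rho'(f(x_1),f(x_2))g(a)$ and $f(\psi(a_1,a_2)x)=\psi'(g(a_1),g(a_2))f(x)$. Infinitesimal deformation: a quadruple $(\omega,\theta,\nu,\phi)$ of trilinear maps $\omega:\mathfrak g^3\to\mathfrak g$ and $\theta:\mathfrak h^3\to\mathfrak h$ (alternating), $\nu:\mathfrak g\times\mathfrak g\times\mathfrak h\to\mathfrak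 h$ and $\phi:\mathfrak h\times\mathfrak h\times\mathfrak g\to\mathfrak g$ (alternating in the first two arguments) such that the $\mathbf k[t]/(t^2)$-multilinear extensions of $\mu_t=[\cdot,\cdot,\cdot]+t\omega$ on $\mathfrak g[t]/(t^2)$, $\nu_t=[\cdot,\cdot,\cdot]+t\theta$ on $\mathfrak h[t]/(t^2)$, $\rho_t=\rho+t\nu$, $\psi_t=\psi+t\phi$ make $((\mathfrak g[t]/(t^2),\mu_t),(\mathfrak h[t]/(t^2),\nu_t),\rho_t,\psi_t)$ a matched pair of 3-Lie algebras over $\mathbf k[t]/(t^2)$. Two infinitesimal deformations are equivalent ($\sim$) if there are linear maps $f:\mathfrak g\to\mathfrak g$, $g:\mathfrak h\to\mathfrak h$ such that $(\mathrm{id}_{\mathfrak g}+tf,\mathrm{id}_{\mathfrak h}+tg)$ is a morphism from the matched pair over $\mathbf k[t]/(t^2)$ defined by the first to that defined by the second. Cohomology: a 2-cochain is a quadruple $(\omega,\theta,\nu,\phi)$ with $\omega\in\mathrm{Hom}(\wedge^3\mathfrak g,\mathfrak g)$, $\theta\in\mathrm{Hom}(\wedge^3\mathfrak h,\mathfrak h)$, $\nu\in\mathrm{Hom}(\wedge^2\mathfrak g\otimes\mathfrak h,\mathfrak h)$, $\phi\in\mathrm{Hom}(\wedge^2\mathfrak h\otimes\mathfrak g,\mathfrak g)$. It is a 2-cocycle if for all arguments: (Z1) $[\omega(x_1,x_2,x_3),x_4,x_5]+[x_3,\omega(x_1,x_2,x_4),x_5]+[x_3,x_4,\omega(x_1,x_2,x_5)]+\omega([x_1,x_2,x_3],x_4,x_5)+\omega(x_3,[x_1,x_2,x_4],x_5)+\omega(x_3,x_4,[x_1,x_2,x_5])=[x_1,x_2,\omega(x_3,x_4,x_5)]+\omega(x_1,x_2,[x_3,x_4,x_5])$;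 (Z2) the same identity for $\theta$ on $\mathfrak h$; (Z3) $\rho(x_1,x_2)\theta(a_1,a_2,a_3)+\nu(x_1,x_2)[a_1,a_2,a_3]=[\nu(x_1,x_2)a_1,a_2,a_3]+[a_1,\nu(x_1,x_2)a_2,a_3]+[a_1,a_2,\nu(x_1,x_2)a_3]+\theta(\rho(x_1,x_2)a_1,a_2,a_3)+\theta(a_1,\rho(x_1,x_2)a_2,a_3)+\theta(a_1,a_2,\rho(x_1,x_2)a_3)$; (Z4) $\psi(a_1,a_2)\omega(x_1,x_2,x_3)+\phi(a_1,a_2)[x_1,x_2,x_3]=[\phi(a_1,a_2)x_1,x_2,x_3]+[x_1,\phi(a_1,a_2)x_2,x_3]+[x_1,x_2,\phi(a_1,a_2)x_3]+\omega(\psi(a_1,a_2)x_1,x_2,x_3)+\omega(x_1,\psi(a_1,a_2)x_2,x_3)+\omega(x_1,x_2,\psi(a_1,a_2)x_3)$; (Z5) $\psi(\nu(x_1,x_2)a_1,a_2)x_3+\phi(\rho(x_1,x_2)a_1,a_2)x_3=\psi(\nu(x_1,x_3)a_2,a_1)x_2+\phi(\rho(x_1,x_3)a_2,a_1)x_2-\psi(\nu(x_2,x_3)a_2,a_1)x_1-\phi(\rho(x_2,x_3)a_2,a_1)x_1+[x_1,x_2,\phi(a_1,a_2)x_3]+\omega(x_1,x_2,\psi(a_1,a_2)x_3)$; (Z6) $\rho(\phi(a_1,a_2)x_1,x_2)a_3+\nu(\psi(a_1,a_2)x_1,x_2)a_3=\rho(\phi(a_1,a_3)x_2,x_1)a_2+\nu(\psi(a_1,a_3)x_2,x_1)a_2-\rho(\phi(a_2,a_3)x_2,x_1)a_1-\nu(\psi(a_2,a_3)x_2,x_1)a_1+[a_1,a_2,\nu(x_1,x_2)a_3]+\theta(a_1,a_2,\rho(x_1,x_2)a_3)$;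 (Z7) $\omega(\psi(a_1,a_2)x_1,x_2,x_3)+[\phi(a_1,a_2)x_1,x_2,x_3]=\psi(a_1,a_2)\omega(x_1,x_2,x_3)+\phi(a_1,a_2)[x_1,x_2,x_3]+\phi(\rho(x_2,x_3)a_1,a_2)x_1+\psi(\nu(x_2,x_3)a_1,a_2)x_1+\phi(a_1,\rho(x_2,x_3)a_2)x_1+\psi(a_1,\nu(x_2,x_3)a_2)x_1$; (Z8) $\theta(\rho(x_1,x_2)a_1,a_2,a_3)+[\nu(x_1,x_2)a_1,a_2,a_3]=\rho(x_1,x_2)\theta(a_1,a_2,a_3)+\nu(x_1,x_2)[a_1,a_2,a_3]+\nu(\psi(a_2,a_3)x_1,x_2)a_1+\rho(\phi(a_2,a_3)x_1,x_2)a_1+\nu(x_1,\psi(a_2,a_3)x_2)a_1+\rho(x_1,\phi(a_2,a_3)x_2)a_1$. For linear maps $N_1:\mathfrak g\to\mathfrak g$, $N_2:\mathfrak h\to\mathfrak h$, the 2-coboundary $D_1(N_1,N_2)=(\omega,\theta,\nu,\phi)$ is $\omega(x_1,x_2,x_3)=[N_1x_1,x_2,x_3]+[x_1,N_1x_2,x_3]+[x_1,x_2,N_1x_3]-N_1[x_1,x_2,x_3]$, $\theta(a_1,a_2,a_3)=[N_2a_1,a_2,a_3]+[a_1,N_2a_2,a_3]+[a_1,a_2,N_2a_3]-N_2[a_1,a_2,a_3]$, $\nu(x_1,x_2)a=\rho(x_1,x_2)N_2a-N_2(\rho(x_1,x_2)a)+\rho(N_1x_1,x_2)a+\rho(x_1,N_1x_2)a$,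 $\phi(a_1,a_2)x=\psi(a_1,a_2)N_1x-N_1(\psi(a_1,a_2)x)+\psi(N_2a_1,a_2)x+\psi(a_1,N_2a_2)x$. Every 2-coboundary is a 2-cocycle, and $H^2_{\mathrm{MPL}}(\mathfrak g,\mathfrak h,\rho,\psi)$ is the quotient space of 2-cocycles by 2-coboundaries. *)

(* Defs.v *)
From HB Require Import structures.
From mathcomp Require Import all_boot all_order all_algebra.
From mathcomp Require Import boolp functions.

Set Implicit Arguments.
Unset Strict Implicit.
Unset Printing Implicit Defensive.

Import GRing.Theory.
Local Open Scope ring_scope.

Section Multilinear.
Variable R : comNzRingType.

Definition trilinear (U V W Z : lmodType R) (m : U -> V -> W -> Z) : Prop :=
  [/\ forall y z, linear (fun x => m x y z),
      forall x z, linear (fun y => m x y z)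
    & forall x y, linear (fun z => m x y z)].

(* "Vanishes on repeated arguments", which is stronger than skew-symmetry in  *)
(* characteristic 2.                                                          *)
Definition alternating12 (U W Z : lmodType R) (m : U -> U -> W -> Z) : Prop :=
  forall x z, m x x z = 0.

Definition alternating3 (U Z : lmodType R) (m : U -> U -> U -> Z) : Prop :=
  [/\ forall x y, m x x y = 0, forall x y, m x y x = 0
    & forall x y, m x y y = 0].

Definition three_Lie (V : lmodType R) (b : V -> V -> V -> V) : Prop :=
  [/\ trilinear b, alternating3 b
    & forall x1 x2 y1 y2 y3,
        b x1 x2 (b y1 y2 y3) =
        b (b x1 x2 y1) y2 y3 + b y1 (b x1 x2 y2) y3 + b y1 y2 (b x1 x2 y3)].

Definition three_Lie_hom (V W : lmodType R) (b : V -> V -> V -> V)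
    (c : W -> W -> W -> W) (f : V -> W) : Prop :=
  linear f /\ forall x y z, f (b x y z) = c (f x) (f y) (f z).

End Multilinear.

(* The common shape of the structure maps ([,,]_g, [,,]_h, rho, psi) of a     *)
(* matched pair and of the cochains (omega, theta, nu, phi); a product of     *)
(* function spaces, so that it is an R-module under pointwise operations.     *)
Definition quadruple (R : comNzRingType) (g h : lmodType R) : Type :=
  ((g -> g -> g -> g) * (h -> h -> h -> h)
   * (g -> g -> h -> h) * (h -> h -> g -> g))%type.

HB.instance Definition _ (R : comNzRingType) (g h : lmodType R) :=
  GRing.Lmodule.on (quadruple g h).

Section MatchedPairs.
Variable R : comNzRingType.

Section Quadruples.
Variables g h : lmodType R.
Implicit Type q : quadruple g h.

Definition q_ggg q : g -> g -> g -> g := q.1.1.1.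
Definition q_hhh q : h -> h -> h -> h := q.1.1.2.
Definition q_ggh q : g -> g -> h -> h := q.1.2.
Definition q_hhg q : h -> h -> g -> g := q.2.

Definition is_matched_pair q : Prop :=
  let bg := q_ggg q in let bh := q_hhh q in
  let rho := q_ggh q in let psi := q_hhg q in
  [/\ three_Lie bg, three_Lie bh,
      trilinear rho /\ alternating12 rho
    & trilinear psi /\ alternating12 psi] /\
  [/\ forall a1 a2 x1 x2 x3,
        psi a1 a2 (bg x1 x2 x3) =
        bg (psi a1 a2 x1) x2 x3 + bg x1 (psi a1 a2 x2) x3
        + bg x1 x2 (psi a1 a2 x3),
      forall a1 a2 x1 x2 x3,
        - psi (rho x1 x2 a1) a2 x3 =
        - psi (rho x1 x3 a2) a1 x2 + psi (rho x2 x3 a2) a1 x1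
        - bg x1 x2 (psi a1 a2 x3)
    & forall a1 a2 x1 x2 x3,
        bg (psi a1 a2 x1) x2 x3 =
        psi a1 a2 (bg x1 x2 x3) + psi (rho x2 x3 a1) a2 x1
        + psi a1 (rho x2 x3 a2) x1] /\
  [/\ forall x1 x2 a1 a2 a3,
        rho x1 x2 (bh a1 a2 a3) =
        bh (rho x1 x2 a1) a2 a3 + bh a1 (rho x1 x2 a2) a3
        + bh a1 a2 (rho x1 x2 a3),
      forall x1 x2 a1 a2 a3,
        - rho (psi a1 a2 x1) x2 a3 =
        - rho (psi a1 a3 x2) x1 a2 + rho (psi a2 a3 x2) x1 a1
        - bh a1 a2 (rho x1 x2 a3)
    & forall x1 x2 a1 a2 a3,
        bh (rho x1 x2 a1) a2 a3 =
        rho x1 x2 (bh a1 a2 a3) + rho (psi a2 a3 x1) x2 a1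
        + rho x1 (psi a2 a3 x2) a1].

Record matched_pair := MatchedPair {
  mp_maps :> quadruple g h;
  mp_axioms : is_matched_pair mp_maps
}.

Definition is_cochain2 q : Prop :=
  [/\ trilinear (q_ggg q) /\ alternating3 (q_ggg q),
      trilinear (q_hhh q) /\ alternating3 (q_hhh q),
      trilinear (q_ggh q) /\ alternating12 (q_ggh q)
    & trilinear (q_hhg q) /\ alternating12 (q_hhg q)].

End Quadruples.

Definition mp_morphism (g h g' h' : lmodType R) (q : quadruple g h)
    (q' : quadruple g' h') (f : g -> g') (u : h -> h') : Prop :=
  [/\ three_Lie_hom (q_ggg q) (q_ggg q') f,
      three_Lie_hom (q_hhh q) (q_hhh q') u,
      forall x1 x2 a, u (q_ggh q x1 x2 a) = q_ggh q' (f x1) (f x2) (u a)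
    & forall a1 a2 x, f (q_hhg q a1 a2 x) = q_hhg q' (u a1) (u a2) (f x)].

Lemma mp_morphism_id (g h : lmodType R) (q : quadruple g h) :
  mp_morphism q q id id.
Proof. by split=> //; split=> // a x y. Qed.

Lemma mp_morphism_comp (g h : lmodType R) (q q' q'' : quadruple g h)
    (f f' : g -> g) (u u' : h -> h) :
  mp_morphism q q' f u -> mp_morphism q' q'' f' u' ->
  mp_morphism q q'' (f' \o f) (u' \o u).
Proof.
case=> [[lf fb] [lu ub] r p] [[lf' fb'] [lu' ub'] r' p'].
split=> /= [||x1 x2 a|a1 a2 x]; rewrite ?r ?p //; split.
- by move=> a x y /=; rewrite lf lf'.
- by move=> x y z /=; rewrite fb fb'.
- by move=> a x y /=; rewrite lu lu'.
- by move=> x y z /=; rewrite ub ub'.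
Qed.

Lemma mp_morphism_inv (g h : lmodType R) (q q' : quadruple g h)
    (f f' : g -> g) (u u' : h -> h) :
  cancel f f' -> cancel f' f -> cancel u u' -> cancel u' u ->
  mp_morphism q q' f u -> mp_morphism q' q f' u'.
Proof.
move=> fK f'K uK u'K [[lf fb] [lu ub] r p].
split=> [||x1 x2 a|a1 a2 x]; last 2 first.
- by rewrite -{1}[x1]f'K -{1}[x2]f'K -{1}[a]u'K -r uK.
- by rewrite -{1}[a1]u'K -{1}[a2]u'K -{1}[x]f'K -p fK.
- split=> [a x y|x y z]; first by rewrite -{1}[x]f'K -{1}[y]f'K -lf fK.
  by rewrite -{1}[x]f'K -{1}[y]f'K -{1}[z]f'K -fb fK.
- split=> [a x y|x y z]; first by rewrite -{1}[x]u'K -{1}[y]u'K -lu uK.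
  by rewrite -{1}[x]u'K -{1}[y]u'K -{1}[z]u'K -ub uK.
Qed.

End MatchedPairs.

Definition tring (R : comNzRingType) := {poly %/ ('X^2 : {poly R})}.
HB.instance Definition _ (R : comNzRingType) := GRing.ComNzRing.on (tring R).

Definition tvar (R : comNzRingType) : tring R := qpolyX _.

(* The R[t]/(t^2)-module V[t]/(t^2): the pair (x0, x1) stands for x0 + t x1.  *)
Definition tmod (R : comNzRingType) (V : lmodType R) : Type := (V * V)%type.
HB.instance Definition _ (R : comNzRingType) (V : lmodType R) :=
  GRing.Zmodule.on (tmod V).

Section TruncatedPolynomials.
Variable R : comNzRingType.

Lemma tringM (p q : tring R) :
  ((p * q : tring R)`_0 = p`_0 * q`_0) *
  ((p * q : tring R)`_1 = p`_0 * q`_1 + p`_1 * q`_0).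
Proof.
have e i : (i < 2)%N -> (p * q : tring R)`_i = ((p : {poly R}) * q)`_i.
  move=> i2; rewrite poly_of_qpolyM; set pq := (_ : {poly R}) * _.
  rewrite mk_monic_Xn [in RHS](Pdiv.RingMonic.rdivp_eq (monicXn R 2) pq).
  by rewrite coefD coefMXn i2 add0r.
by split; rewrite e // coefM !big_ord_recl big_ord0 ?addr0.
Qed.

Section Scaling.
Variable V : lmodType R.

Definition tscale (p : tring R) (x : tmod V) : tmod V :=
  (p`_0 *: x.1, p`_0 *: x.2 + p`_1 *: x.1).

Lemma tscaleA p q x : tscale p (tscale q x) = tscale (p * q) x.
Proof.
rewrite /tscale /= !tringM !scalerDr !scalerDl !scalerA; congr pair.
by rewrite addrA.
Qed.

Lemma tscale1 : left_id 1 tscale.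
Proof.
case=> x y; by rewrite /tscale /= !coefC /= scale0r addr0 !scale1r.
Qed.

Lemma tscaleDr : right_distributive tscale +%R.
Proof.
by move=> p x y; rewrite /tscale /= !scalerDr; congr pair; rewrite addrACA.
Qed.

Lemma tscaleDl x : {morph tscale^~ x : p q / p + q}.
Proof.
by move=> p q; rewrite /tscale /= !coefD !scalerDl; congr pair; exact: addrACA.
Qed.

HB.instance Definition _ :=
  GRing.Zmodule_isLmodule.Build (tring R) (tmod V)
    tscaleA tscale1 tscaleDr tscaleDl.

End Scaling.

Lemma tvar_scale (V : lmodType R) (x : tmod V) : tvar R *: x = (0, x.1).
Proof.
rewrite [LHS]/(tscale _ _) /tscale qpolyXE ?monicXn ?size_polyXn //.
by rewrite !coefX /= !scale0r add0r scale1r.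
Qed.

Definition tconst (V : lmodType R) (x : V) : tmod V := (x, 0).

Lemma tmodE (V : lmodType R) (x : tmod V) :
  x = tvar R *: tconst x.2 + tconst x.1.
Proof.
by rewrite tvar_scale; case: x => a b; congr pair; rewrite /= ?add0r ?addr0.
Qed.

(* The R[t]/(t^2)-multilinear extension of m + t n (the terms of degree >= 2  *)
(* in t vanish); see [text_uniq].                                             *)
Definition text (U V W Z : lmodType R) (m n : U -> V -> W -> Z)
    (x : tmod U) (y : tmod V) (z : tmod W) : tmod Z :=
  (m x.1 y.1 z.1,
   n x.1 y.1 z.1 + (m x.2 y.1 z.1 + m x.1 y.2 z.1 + m x.1 y.1 z.2)).

Lemma text_uniq (U V W Z : lmodType R) (m n : U -> V -> W -> Z)
    (F : tmod U -> tmod V -> tmod W -> tmod Z) :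
  trilinear F ->
  (forall x y z,
     F (tconst x) (tconst y) (tconst z) =
     tconst (m x y z) + tvar R *: tconst (n x y z)) ->
  F = text m n.
Proof.
move=> [F1 F2 F3] Fmn.
apply/funext=> x; apply/funext=> y; apply/funext=> z.
rewrite [x in LHS]tmodE [y in LHS]tmodE [z in LHS]tmodE !F1 !F2 !F3 !Fmn.
rewrite !tvar_scale /= /text.
by congr pair => /=; rewrite ?(addr0, add0r) // [RHS]addrC !addrA.
Qed.

Definition id_plus_t (V : lmodType R) (f : V -> V) (x : tmod V) : tmod V :=
  x + tvar R *: ((f x.1, f x.2) : tmod V).

End TruncatedPolynomials.

Section Deformations.
Variables (R : comNzRingType) (g h : lmodType R) (M : matched_pair g h).

Definition deformed (d : quadruple g h) : quadruple (tmod g) (tmod h) :=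
  (text (q_ggg M) (q_ggg d), text (q_hhh M) (q_hhh d),
   text (q_ggh M) (q_ggh d), text (q_hhg M) (q_hhg d)).

Definition is_deformation (d : quadruple g h) : Prop :=
  is_cochain2 d /\ is_matched_pair (deformed d).

Definition deformation := {d : quadruple g h | `[< is_deformation d >]}.

Definition deformation_equiv (d d' : deformation) : Prop :=
  exists (f : {linear g -> g}) (u : {linear h -> h}),
    mp_morphism (deformed (val d)) (deformed (val d'))
      (id_plus_t f) (id_plus_t u).

Definition deformation_equivb : rel deformation :=
  fun d d' => `[< deformation_equiv d d' >].

Lemma deformation_equivb_equiv : equiv_class_of deformation_equivb.
Proof.
have tE (V : lmodType R) (f : {linear V -> V}) x :
    id_plus_t f x = (x.1, x.2 + f x.1).
  by rewrite /id_plus_t tvar_scale; congr pair; rewrite addr0.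
have t0 (V : lmodType R) : id_plus_t (\0 : {linear V -> V}) = id.
  by apply/funext=> -[x y]; rewrite tE addr0.
have tK (V : lmodType R) (f f' : {linear V -> V}) :
    f =1 \- f' -> cancel (id_plus_t f) (id_plus_t f').
  by move=> ff' [x y]; rewrite !tE /= ff' /= addrNK.
have symm d d' : deformation_equiv d d' -> deformation_equiv d' d.
  case=> f [u fu]; exists (\- f), (\- u).
  by apply: mp_morphism_inv fu; apply: tK => x /=; rewrite ?opprK.
split=> [d|d d'|d' d d''].
- by apply/asboolP; exists \0, \0; rewrite !t0; exact: mp_morphism_id.
- by apply/asboolP/asboolP; apply: symm.
- move=> /asboolP[f [u fu]] /asboolP[f' [u' fu']]; apply/asboolP.
  exists (f \+ f'), (u \+ u').
  have tD (V : lmodType R) (k k' : {linear V -> V}) :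
      id_plus_t (k \+ k') = id_plus_t k' \o id_plus_t k.
    by apply/funext=> -[x y]; rewrite /comp !tE /= addrA.
  by rewrite !tD; exact: mp_morphism_comp fu fu'.
Qed.

Canonical deformation_equivb_equivRel :=
  EquivRelPack deformation_equivb_equiv.

Definition deformation_classes := {eq_quot deformation_equivb}%qT.

End Deformations.

Section Cohomology.
Variables (R : comNzRingType) (g h : lmodType R) (M : matched_pair g h).
Local Notation bg := (q_ggg M).
Local Notation bh := (q_hhh M).
Local Notation rho := (q_ggh M).
Local Notation psi := (q_hhg M).

Record is_cocycle2 (c : quadruple g h) : Prop := IsCocycle2 {
  cocycle2_cochain : is_cochain2 c;
  cocycle2_Z1 : let w := q_ggg c in forall x1 x2 x3 x4 x5,
    bg (w x1 x2 x3) x4 x5 + bg x3 (w x1 x2 x4) x5 + bg x3 x4 (w x1 x2 x5)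
    + w (bg x1 x2 x3) x4 x5 + w x3 (bg x1 x2 x4) x5 + w x3 x4 (bg x1 x2 x5) =
    bg x1 x2 (w x3 x4 x5) + w x1 x2 (bg x3 x4 x5);
  cocycle2_Z2 : let th := q_hhh c in forall a1 a2 a3 a4 a5,
    bh (th a1 a2 a3) a4 a5 + bh a3 (th a1 a2 a4) a5 + bh a3 a4 (th a1 a2 a5)
    + th (bh a1 a2 a3) a4 a5 + th a3 (bh a1 a2 a4) a5
    + th a3 a4 (bh a1 a2 a5) =
    bh a1 a2 (th a3 a4 a5) + th a1 a2 (bh a3 a4 a5);
  cocycle2_Z3 : let th := q_hhh c in let nu := q_ggh c in
    forall x1 x2 a1 a2 a3,
    rho x1 x2 (th a1 a2 a3) + nu x1 x2 (bh a1 a2 a3) =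
    bh (nu x1 x2 a1) a2 a3 + bh a1 (nu x1 x2 a2) a3 + bh a1 a2 (nu x1 x2 a3)
    + th (rho x1 x2 a1) a2 a3 + th a1 (rho x1 x2 a2) a3
    + th a1 a2 (rho x1 x2 a3);
  cocycle2_Z4 : let w := q_ggg c in let phi := q_hhg c in
    forall a1 a2 x1 x2 x3,
    psi a1 a2 (w x1 x2 x3) + phi a1 a2 (bg x1 x2 x3) =
    bg (phi a1 a2 x1) x2 x3 + bg x1 (phi a1 a2 x2) x3
    + bg x1 x2 (phi a1 a2 x3)
    + w (psi a1 a2 x1) x2 x3 + w x1 (psi a1 a2 x2) x3
    + w x1 x2 (psi a1 a2 x3);
  cocycle2_Z5 : let w := q_ggg c in let nu := q_ggh c in
    let phi := q_hhg c in forall x1 x2 x3 a1 a2,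
    psi (nu x1 x2 a1) a2 x3 + phi (rho x1 x2 a1) a2 x3 =
    psi (nu x1 x3 a2) a1 x2 + phi (rho x1 x3 a2) a1 x2
    - psi (nu x2 x3 a2) a1 x1 - phi (rho x2 x3 a2) a1 x1
    + bg x1 x2 (phi a1 a2 x3) + w x1 x2 (psi a1 a2 x3);
  cocycle2_Z6 : let th := q_hhh c in let nu := q_ggh c in
    let phi := q_hhg c in forall a1 a2 a3 x1 x2,
    rho (phi a1 a2 x1) x2 a3 + nu (psi a1 a2 x1) x2 a3 =
    rho (phi a1 a3 x2) x1 a2 + nu (psi a1 a3 x2) x1 a2
    - rho (phi a2 a3 x2) x1 a1 - nu (psi a2 a3 x2) x1 a1
    + bh a1 a2 (nu x1 x2 a3) + th a1 a2 (rho x1 x2 a3);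
  cocycle2_Z7 : let w := q_ggg c in let nu := q_ggh c in
    let phi := q_hhg c in forall a1 a2 x1 x2 x3,
    w (psi a1 a2 x1) x2 x3 + bg (phi a1 a2 x1) x2 x3 =
    psi a1 a2 (w x1 x2 x3) + phi a1 a2 (bg x1 x2 x3)
    + phi (rho x2 x3 a1) a2 x1 + psi (nu x2 x3 a1) a2 x1
    + phi a1 (rho x2 x3 a2) x1 + psi a1 (nu x2 x3 a2) x1;
  cocycle2_Z8 : let th := q_hhh c in let nu := q_ggh c in
    let phi := q_hhg c in forall x1 x2 a1 a2 a3,
    th (rho x1 x2 a1) a2 a3 + bh (nu x1 x2 a1) a2 a3 =
    rho x1 x2 (th a1 a2 a3) + nu x1 x2 (bh a1 a2 a3)
    + nu (psi a2 a3 x1) x2 a1 + rho (phi a2 a3 x1) x2 a1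
    + nu x1 (psi a2 a3 x2) a1 + rho x1 (phi a2 a3 x2) a1
}.

Definition D1 (N1 : g -> g) (N2 : h -> h) : quadruple g h :=
  (fun x1 x2 x3 => bg (N1 x1) x2 x3 + bg x1 (N1 x2) x3 + bg x1 x2 (N1 x3)
                   - N1 (bg x1 x2 x3),
   fun a1 a2 a3 => bh (N2 a1) a2 a3 + bh a1 (N2 a2) a3 + bh a1 a2 (N2 a3)
                   - N2 (bh a1 a2 a3),
   fun x1 x2 a => rho x1 x2 (N2 a) - N2 (rho x1 x2 a)
                  + rho (N1 x1) x2 a + rho x1 (N1 x2) a,
   fun a1 a2 x => psi a1 a2 (N1 x) - N1 (psi a1 a2 x)
                  + psi (N2 a1) a2 x + psi a1 (N2 a2) x).

Definition is_coboundary2 (c : quadruple g h) : Prop :=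
  exists (N1 : {linear g -> g}) (N2 : {linear h -> h}), c = D1 N1 N2.

Definition Z2 : {pred quadruple g h} := fun c => `[< is_cocycle2 c >].
Definition B2 : {pred quadruple g h} := fun c => `[< is_coboundary2 c >].

Let lin2 (V : lmodType R) (a : R) (x y x' y' : V) :
  (a *: x + y) + (a *: x' + y') = a *: (x + x') + (y + y').
Proof. by rewrite addrACA -scalerDr. Qed.

Let linN (V : lmodType R) (a : R) (x y : V) :
  - (a *: x + y) = a *: (- x) + (- y).
Proof. by rewrite opprD scalerN. Qed.

Let trilinear_lin (U V W Z : lmodType R) (m n : U -> V -> W -> Z) a :
  trilinear m -> trilinear n -> trilinear (a *: m + n).
Proof.
case=> m1 m2 m3 [n1 n2 n3].
have e b (x y x' y' : Z) : a *: (b *: x + y) + (b *: x' + y') =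
    b *: (a *: x + x') + (a *: y + y').
  by rewrite !scalerDr !scalerA (mulrC b a) addrACA.
by split=> x y b z t; rewrite -e /= -?m1 -?n1 -?m2 -?n2 -?m3 -?n3.
Qed.

Let cochain2_lin (a : R) (c c' : quadruple g h) :
  is_cochain2 c -> is_cochain2 c' -> is_cochain2 (a *: c + c').
Proof.
case=> [[t1 [z1 z2 z3]] [t2 [z4 z5 z6]] [t3 z7] [t4 z8]].
case=> [[t1' [z1' z2' z3']] [t2' [z4' z5' z6']] [t3' z7'] [t4' z8']].
have a0 (V : lmodType R) (x y : V) : x = 0 -> y = 0 -> a *: x + y = 0.
  by move=> -> ->; rewrite scaler0 addr0.
split.
- split; first exact: trilinear_lin t1 t1'.
  by split=> x y; [exact: a0 (z1 x y) (z1' x y) | exact: a0 (z2 x y) (z2' x y)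
                  | exact: a0 (z3 x y) (z3' x y)].
- split; first exact: trilinear_lin t2 t2'.
  by split=> x y; [exact: a0 (z4 x y) (z4' x y) | exact: a0 (z5 x y) (z5' x y)
                  | exact: a0 (z6 x y) (z6' x y)].
- by split; [exact: trilinear_lin t3 t3'
            | move=> x y; exact: a0 (z7 x y) (z7' x y)].
- by split; [exact: trilinear_lin t4 t4'
            | move=> x y; exact: a0 (z8 x y) (z8' x y)].
Qed.

Let cochain2_0 : is_cochain2 (0 : quadruple g h).
Proof.
have t0 (U V W Z : lmodType R) : trilinear (0 : U -> V -> W -> Z).
  by split=> x y a z t /=; rewrite scaler0 addr0.
by split; split=> //; split.
Qed.

Let tri1 (U V W Z : lmodType R) (m : U -> V -> W -> Z) (tm : trilinear m)
  a x x' y z : m (a *: x + x') y z = a *: m x y z + m x' y z.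
Proof. by case: tm => m1 m2 m3; exact: m1. Qed.

Let tri2 (U V W Z : lmodType R) (m : U -> V -> W -> Z) (tm : trilinear m)
  a x y y' z : m x (a *: y + y') z = a *: m x y z + m x y' z.
Proof. by case: tm => m1 m2 m3; exact: m2. Qed.

Let tri3 (U V W Z : lmodType R) (m : U -> V -> W -> Z) (tm : trilinear m)
  a x y z z' : m x y (a *: z + z') = a *: m x y z + m x y z'.
Proof. by case: tm => m1 m2 m3; exact: m3. Qed.

Let tri0 (U V W Z : lmodType R) (m : U -> V -> W -> Z) : trilinear m ->
  [/\ forall y z, m 0 y z = 0, forall x z, m x 0 z = 0
    & forall x y, m x y 0 = 0].
Proof.
case=> m1 m2 m3; split=> x y.
- by have := m1 x y (-1) 0 0; rewrite /= scaler0 addr0 scaleN1r addNr.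
- by have := m2 x y (-1) 0 0; rewrite /= scaler0 addr0 scaleN1r addNr.
- by have := m3 x y (-1) 0 0; rewrite /= scaler0 addr0 scaleN1r addNr.
Qed.

Fact Z2_submod_closed : submod_closed Z2.
Proof.
have [[[tbg _ _] [tbh _ _] [trho _] [tpsi _]] _] := mp_axioms M.
split=> [|a c c' /asboolP[cc z1 z2 z3 z4 z5 z6 z7 z8]].
  have w0 x y z : q_ggg (0 : quadruple g h) x y z = 0 by [].
  have t0 x y z : q_hhh (0 : quadruple g h) x y z = 0 by [].
  have n0 x y z : q_ggh (0 : quadruple g h) x y z = 0 by [].
  have p0 x y z : q_hhg (0 : quadruple g h) x y z = 0 by [].
  have [bg1 bg2 bg3] := tri0 tbg; have [bh1 bh2 bh3] := tri0 tbh.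
  have [r1 r2 r3] := tri0 trho; have [s1 s2 s3] := tri0 tpsi.
  have E0 := (bg1, bg2, bg3, bh1, bh2, bh3, r1, r2, r3, s1, s2, s3).
  apply/asboolP; split; [exact: cochain2_0|..]; cbv zeta; intros;
    by rewrite !(w0, t0, n0, p0) ?E0 ?(oppr0, addr0).
move=> /asboolP[cc' z1' z2' z3' z4' z5' z6' z7' z8'].
have E := (tri1 tbg, tri2 tbg, tri3 tbg, tri1 tbh, tri2 tbh, tri3 tbh,
  tri1 trho, tri3 trho, tri2 trho, tri1 tpsi, tri2 tpsi, tri3 tpsi).
have wE x y z : q_ggg (a *: c + c') x y z =
  a *: q_ggg c x y z + q_ggg c' x y z by [].
have tE x y z : q_hhh (a *: c + c') x y z =
  a *: q_hhh c x y z + q_hhh c' x y z by [].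
have nE x y z : q_ggh (a *: c + c') x y z =
  a *: q_ggh c x y z + q_ggh c' x y z by [].
have pE x y z : q_hhg (a *: c + c') x y z =
  a *: q_hhg c x y z + q_hhg c' x y z by [].
apply/asboolP; split; first exact: cochain2_lin.
- by move=> w *; rewrite /w !wE !E !lin2 z1 z1'.
- by move=> t *; rewrite /t !tE !E !lin2 z2 z2'.
- by move=> t n *; rewrite /t /n !tE !nE !E !lin2 z3 z3'.
- by move=> w p *; rewrite /w /p !wE !pE !E !lin2 z4 z4'.
- by move=> w n p *; rewrite /w /n /p !wE !nE !pE !E !(linN, lin2) z5 z5'.
- by move=> t n p *; rewrite /t /n /p !tE !nE !pE !E !(linN, lin2) z6 z6'.
- by move=> w n p *; rewrite /w /n /p !wE !nE !pE !E !lin2 z7 z7'.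
- by move=> t n p *; rewrite /t /n /p !tE !nE !pE !E !lin2 z8 z8'.
Qed.

Fact B2_submod_closed : submod_closed B2.
Proof.
have [[[tbg _ _] [tbh _ _] [trho _] [tpsi _]] _] := mp_axioms M.
have [bg1 bg2 bg3] := tri0 tbg; have [bh1 bh2 bh3] := tri0 tbh.
have [r1 r2 r3] := tri0 trho; have [s1 s2 s3] := tri0 tpsi.
have E := (tri1 tbg, tri2 tbg, tri3 tbg, tri1 tbh, tri2 tbh, tri3 tbh,
  tri1 trho, tri3 trho, tri2 trho, tri1 tpsi, tri2 tpsi, tri3 tpsi).
split=> [|a c c' /asboolP[N1 [N2 ->]] /asboolP[N1' [N2' ->]]].
  apply/asboolP; exists \0, \0; rewrite /D1; congr (_, _, _, _);
    do 3![apply/funext=> ?] => /=.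
  - by rewrite bg1 bg2 bg3 !addr0 subr0.
  - by rewrite bh1 bh2 bh3 !addr0 subr0.
  - by rewrite r1 r2 r3 !addr0 subr0.
  - by rewrite s1 s2 s3 !addr0 subr0.
apply/asboolP; exists ((a \*: N1) \+ N1'), ((a \*: N2) \+ N2').
rewrite /D1; congr (_, _, _, _); do 3![apply/funext=> ?] => /=.
- by rewrite !E !(linN, lin2).
- by rewrite !E !(linN, lin2).
- by rewrite !E !(linN, lin2).
- by rewrite !E !(linN, lin2).
Qed.

HB.instance Definition _ :=
  GRing.isSubmodClosed.Build R (quadruple g h) Z2 Z2_submod_closed.
HB.instance Definition _ :=
  GRing.isSubmodClosed.Build R (quadruple g h) B2 B2_submod_closed.

Record cocycle2 := Cocycle2 {
  cocycle2_val :> quadruple g h;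
  _ : cocycle2_val \in Z2
}.

HB.instance Definition _ := [isSub for cocycle2_val].
HB.instance Definition _ := [Choice of cocycle2 by <:].
HB.instance Definition _ := [SubChoice_isSubLmodule of cocycle2 by <:].

(* B2 read inside the module Z2 (in fact B2 is contained in Z2, so that no    *)
(* coboundary is lost).                                                       *)
Definition coboundary2 : {pred cocycle2} := fun c => val c \in B2.

Fact coboundary2_zmod_closed : zmod_closed coboundary2.
Proof.
split; first exact: (rpred0 B2).
by move=> c c' Bc Bc'; exact: (@rpredB _ B2 (val c) (val c')).
Qed.

HB.instance Definition _ :=
  GRing.isZmodClosed.Build cocycle2 coboundary2 coboundary2_zmod_closed.

Definition H2 := Quotient.quot coboundary2.
HB.instance Definition _ := Choice.on H2.
HB.instance Definition _ := GRing.Zmodule.on H2.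
HB.instance Definition _ : EqQuotient cocycle2 (Quotient.equiv coboundary2) H2
  := EqQuotient.on H2.

Local Open Scope quotient_scope.

Fact coboundary2Z (a : R) (c : cocycle2) :
  c \in coboundary2 -> a *: c \in coboundary2.
Proof. by move=> Bc; exact: (@rpredZ _ _ B2 a (val c)). Qed.

Definition H2_scale (a : R) (x : H2) : H2 := \pi_H2 (a *: repr x).

Fact pi_scale a (c : cocycle2) : \pi_H2 (a *: c) = H2_scale a (\pi_H2 c).
Proof.
apply/eqP; rewrite piE; rewrite Quotient.equivE -scalerBr.
apply: coboundary2Z; rewrite -Quotient.equivE.
by case: piP => c' /eqP; rewrite piE.
Qed.

Fact H2_scaleA a b x : H2_scale a (H2_scale b x) = H2_scale (a * b) x.
Proof. elim/quotP: x => c _.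
by rewrite -(pi_scale b c) -(pi_scale a (b *: c)) -pi_scale scalerA. Qed.

Fact H2_scale1 : left_id 1 H2_scale.
Proof. by elim/quotP=> c _; rewrite -pi_scale scale1r. Qed.

Fact H2_scaleDr : right_distributive H2_scale +%R.
Proof.
move=> a; elim/quotP=> c _; elim/quotP=> c' _.
rewrite -(raddfD \pi_H2) -(pi_scale a (c + c')) -(pi_scale a c).
rewrite -(pi_scale a c') -(raddfD \pi_H2).
by rewrite scalerDr.
Qed.

Fact H2_scaleDl x : {morph H2_scale^~ x : a b / a + b}.
Proof.
move=> a b; elim/quotP: x => c _.
rewrite -(pi_scale (a + b) c) -(pi_scale a c) -(pi_scale b c).
by rewrite -(raddfD \pi_H2) scalerDl.
Qed.

HB.instance Definition _ := GRing.Zmodule_isLmodule.Build R H2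
  H2_scaleA H2_scale1 H2_scaleDr H2_scaleDl.

End Cohomology.

(* Main.v *)
(* Expanding each matched pair axiom for the deformed maps in powers of t, the
   constant term is the axiom for the undeformed maps and the coefficient of t
   is one of the cocycle identities (Z1)-(Z8), so infinitesimal deformations
   and 2-cocycles are the same quadruples; both sides of an axiom being linear
   over k[t]/(t^2) in each argument, it suffices to compare them on t-free
   arguments.  The coefficient of t in the condition that (id + t f, id + t u)
   be a morphism from d to d' reads d - d' = D1 f u, so equivalent deformations
   are exactly the cohomologous cocycles. *)
From HB Require Import structures.
Require Import Defs.
From mathcomp Require Import all_boot all_order all_algebra.
From mathcomp Require Import boolp functions.

Set Implicit Arguments.
Unset Strict Implicit.
Unset Printing Implicit Defensive.

Import GRing.Theory.
Local Open Scope ring_scope.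

(** * Elementary calculus of trilinear and linear maps *)

Section Trilinear.
Variables (R : comNzRingType) (U V W Z : lmodType R) (m : U -> V -> W -> Z).
Hypothesis tm : trilinear m.

Lemma trilinearD1 x x' y z : m (x + x') y z = m x y z + m x' y z.
Proof. by case: tm => l _ _; have := l y z 1 x x'; rewrite !scale1r. Qed.

Lemma trilinearD2 x y y' z : m x (y + y') z = m x y z + m x y' z.
Proof. by case: tm => _ l _; have := l x z 1 y y'; rewrite !scale1r. Qed.

Lemma trilinearD3 x y z z' : m x y (z + z') = m x y z + m x y z'.
Proof. by case: tm => _ _ l; have := l x y 1 z z'; rewrite !scale1r. Qed.

Lemma trilinear01 y z : m 0 y z = 0.
Proof. by apply: (addrI (m 0 y z)); rewrite -trilinearD1 !addr0. Qed.

Lemma trilinear02 x z : m x 0 z = 0.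
Proof. by apply: (addrI (m x 0 z)); rewrite -trilinearD2 !addr0. Qed.

Lemma trilinear03 x y : m x y 0 = 0.
Proof. by apply: (addrI (m x y 0)); rewrite -trilinearD3 !addr0. Qed.

Lemma trilinearZ1 a x y z : m (a *: x) y z = a *: m x y z.
Proof.
by case: tm => l _ _; have := l y z a x 0; rewrite trilinear01 !addr0.
Qed.

Lemma trilinearZ2 a x y z : m x (a *: y) z = a *: m x y z.
Proof.
by case: tm => _ l _; have := l x z a y 0; rewrite trilinear02 !addr0.
Qed.

Lemma trilinearZ3 a x y z : m x y (a *: z) = a *: m x y z.
Proof.
by case: tm => _ _ l; have := l x y a z 0; rewrite trilinear03 !addr0.
Qed.

Definition trilinearE := (trilinearD1, trilinearD2, trilinearD3,
  trilinearZ1, trilinearZ2, trilinearZ3).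

Definition trilinear0 := (trilinear01, trilinear02, trilinear03).

Lemma trilinear_linear3 x y : linear (m x y).
Proof. by case: tm. Qed.

Section Composition.
Variable T : lmodType R.

Lemma trilinear_comp1 (f : T -> U) y z :
  linear f -> linear (fun t => m (f t) y z).
Proof. by move=> lf a s t; rewrite lf trilinearD1 trilinearZ1. Qed.

Lemma trilinear_comp2 (f : T -> V) x z :
  linear f -> linear (fun t => m x (f t) z).
Proof. by move=> lf a s t; rewrite lf trilinearD2 trilinearZ2. Qed.

Lemma trilinear_comp3 (f : T -> W) x y :
  linear f -> linear (fun t => m x y (f t)).
Proof. by move=> lf a s t; rewrite lf trilinearD3 trilinearZ3. Qed.

End Composition.
End Trilinear.

(** Polarization: expand [m (x + y) (x + y) z = 0]. *)
Lemma alternating12_skew (R : comNzRingType) (U W Z : lmodType R)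
    (m : U -> U -> W -> Z) x y z :
  trilinear m -> alternating12 m -> m x y z + m y x z = 0.
Proof.
move=> tm am; have := am (x + y) z.
by rewrite !(trilinearD1 tm) !(trilinearD2 tm) !am add0r addr0.
Qed.

Section Linear.
Variables (R : comNzRingType) (U V : lmodType R).

Lemma linear_idfun : linear (fun x : U => x).
Proof. by []. Qed.

Lemma linear_addf (f f' : U -> V) :
  linear f -> linear f' -> linear (fun x => f x + f' x).
Proof. by move=> lf lf' a x y; rewrite lf lf' scalerDr addrACA. Qed.

Lemma linear_oppf (f : U -> V) : linear f -> linear (fun x => - f x).
Proof. by move=> lf a x y; rewrite lf opprD scalerN. Qed.

End Linear.

(** The common shape of both sides of every matched pair identity: five arguments, each occurring
    exactly once in each term. *)
Definition quintilinear (R : comNzRingType) (U1 U2 U3 U4 U5 Z : lmodType R)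
    (F : U1 -> U2 -> U3 -> U4 -> U5 -> Z) : Prop :=
  [/\ forall b c d e, linear (fun a => F a b c d e),
      forall a c d e, linear (fun b => F a b c d e),
      forall a b d e, linear (fun c => F a b c d e),
      forall a b c e, linear (fun d => F a b c d e)
    & forall a b c d, linear (fun e => F a b c d e)].

(** Recursion on the expression: sums and opposites are peeled off, then unification finds the slot
    of a trilinear map that holds the variable. A bare variable in the last slot shows up
    eta-reduced, as [linear (m _ _)]. *)
Ltac prove_linear :=
  intros; cbv beta;
  lazymatch goal with
  | |- linear (fun x => x) => exact: linear_idfun
  | |- linear (fun x => @?F x + @?G x) => apply: linear_addf; prove_linear
  | |- linear (fun x => - @?F x) => apply: linear_oppf; prove_linear
  | |- _ => match goal with
    | tm : trilinear ?m |- linear (?m _ _) => exact: (trilinear_linear3 tm)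
    | tm : trilinear ?m |- linear (fun x => ?m _ _ _) => first
      [ apply: (trilinear_comp1 tm) | apply: (trilinear_comp2 tm)
      | apply: (trilinear_comp3 tm) ]; prove_linear
    end
  end.

(** * Multilinear maps over R[t]/(t^2) *)

Section Extension.
Variable R : comNzRingType.

Lemma linear_tconst_eq (V Z : lmodType R) (F G : tmod V -> tmod Z) :
    linear F -> linear G -> (forall x, F (tconst x) = G (tconst x)) ->
  F =1 G.
Proof. by move=> lF lG FG x; rewrite (tmodE x) lF lG !FG. Qed.

Lemma quintilinear_tconst_eq (U1 U2 U3 U4 U5 Z : lmodType R)
    (F G : tmod U1 -> tmod U2 -> tmod U3 -> tmod U4 -> tmod U5 -> tmod Z) :
    quintilinear F -> quintilinear G ->
    (forall a b c d e,
       F (tconst a) (tconst b) (tconst c) (tconst d) (tconst e) =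
       G (tconst a) (tconst b) (tconst c) (tconst d) (tconst e)) ->
  forall a b c d e, F a b c d e = G a b c d e.
Proof.
move=> [F1 F2 F3 F4 F5] [G1 G2 G3 G4 G5] FG a b c d e.
apply: (linear_tconst_eq (F1 b c d e) (G1 b c d e)) => {}a.
apply: (linear_tconst_eq (F2 _ c d e) (G2 _ c d e)) => {}b.
apply: (linear_tconst_eq (F3 _ _ d e) (G3 _ _ d e)) => {}c.
apply: (linear_tconst_eq (F4 _ _ _ e) (G4 _ _ _ e)) => {}d.
exact: (linear_tconst_eq (F5 _ _ _ _) (G5 _ _ _ _)).
Qed.

Section Text.
Variables (U V W Z : lmodType R) (m n : U -> V -> W -> Z).
Hypotheses (tm : trilinear m) (tn : trilinear n).

Lemma text_trilinear : trilinear (text m n).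
Proof.
split=> x y p z t; congr pair; rewrite /= ?(trilinearE tm) ?(trilinearE tn) //.
(* Coefficient of t: the slot being split yields three terms, since [p *: x + y] has t-part
   [p_0 x_1 + p_1 x_0 + y_1], and every other summand yields two. *)
- rewrite !scalerDr.
  by rewrite [LHS](AC (2*(3*2*2)) ((1*(3*6*8)*4)*(2*(5*7*9)))%AC).
- rewrite !scalerDr.
  by rewrite [LHS](AC (2*(2*3*2)) ((1*(3*5*8)*6)*(2*(4*7*9)))%AC).
- rewrite !scalerDr.
  by rewrite [LHS](AC (2*(2*2*3)) ((1*(3*5*7)*8)*(2*(4*6*9)))%AC).
Qed.

(** On t-free arguments, a nested product has a single outer slot with a t-part, namely the inner
    product, so one mixed term survives. *)
Lemma text_tconst1 x x' y z :
  text m n (x, x') (tconst y) (tconst z) = (m x y z, n x y z + m x' y z).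
Proof. by rewrite /text /= !(trilinear0 tm) !addr0. Qed.

Lemma text_tconst2 x y y' z :
  text m n (tconst x) (y, y') (tconst z) = (m x y z, n x y z + m x y' z).
Proof. by rewrite /text /= !(trilinear0 tm) addr0 add0r. Qed.

Lemma text_tconst3 x y z z' :
  text m n (tconst x) (tconst y) (z, z') = (m x y z, n x y z + m x y z').
Proof. by rewrite /text /= !(trilinear0 tm) !add0r. Qed.

Lemma text_tconst x y z :
  text m n (tconst x) (tconst y) (tconst z) = (m x y z, n x y z).
Proof. by rewrite text_tconst1 (trilinear01 tm) addr0. Qed.

Definition text_tconstE :=
  (text_tconst, text_tconst1, text_tconst2, text_tconst3).

End Text.

(** The coefficient of t contains [m x.2 x.1 z.1 + m x.1 x.2 z.1], which cancels by
    skew-symmetry. *)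
Lemma text_alternating12 (U W Z : lmodType R) (m n : U -> U -> W -> Z) :
    trilinear m -> alternating12 m -> alternating12 n ->
  alternating12 (text m n).
Proof.
move=> tm am an x z; congr pair; rewrite /= ?am ?an // add0r addr0.
exact: alternating12_skew.
Qed.

Lemma text_alternating3 (U Z : lmodType R) (m n : U -> U -> U -> Z) :
    trilinear m -> alternating3 m -> alternating3 n ->
  alternating3 (text m n).
Proof.
move=> tm [m1 m2 m3] [n1 n2 n3].
(* Permuting the slots of [m] brings the pairs (1,3) and (2,3) to the front, where
   [alternating12_skew] applies. *)
have tm2 : trilinear (fun x y z => m x z y) by case: tm.
have tm3 : trilinear (fun x y z => m z x y) by case: tm.
split=> x y; congr pair; rewrite /= ?m1 ?m2 ?m3 ?n1 ?n2 ?n3 // add0r.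
- by rewrite addr0 (alternating12_skew _ _ _ tm).
- by rewrite addrAC addr0 (alternating12_skew _ _ _ tm2).
- by rewrite add0r (alternating12_skew _ _ _ tm3).
Qed.

(* constant term is the identity for the undeformed maps, the coefficient of  *)
(* t is the cocycle condition.                                                *)
Section FirstOrder.
Variables (U V : lmodType R) (b w : U -> U -> U -> U).
Variables (rho nu : U -> U -> V -> V) (psi phi : V -> V -> U -> U).
Hypotheses (tb : trilinear b) (tw : trilinear w).
Hypotheses (trho : trilinear rho) (tnu : trilinear nu).
Hypotheses (tpsi : trilinear psi) (tphi : trilinear phi).
Local Notation bt := (text b w).
Local Notation rhot := (text rho nu).
Local Notation psit := (text psi phi).

(** Kept in the context for [prove_linear] to find. *)
Let tbt : trilinear bt := text_trilinear tb tw.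
Let trhot : trilinear rhot := text_trilinear trho tnu.
Let tpsit : trilinear psit := text_trilinear tpsi tphi.
Let tconstE := (text_tconstE w tb, text_tconstE nu trho, text_tconstE phi tpsi).

Lemma fundamental_identity_text :
    (forall x1 x2 y1 y2 y3,
       b x1 x2 (b y1 y2 y3) =
       b (b x1 x2 y1) y2 y3 + b y1 (b x1 x2 y2) y3 + b y1 y2 (b x1 x2 y3)) ->
  (forall x1 x2 y1 y2 y3,
     bt x1 x2 (bt y1 y2 y3) =
     bt (bt x1 x2 y1) y2 y3 + bt y1 (bt x1 x2 y2) y3 + bt y1 y2 (bt x1 x2 y3))
  <->
  (forall x1 x2 x3 x4 x5,
    b (w x1 x2 x3) x4 x5 + b x3 (w x1 x2 x4) x5 + b x3 x4 (w x1 x2 x5)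
    + w (b x1 x2 x3) x4 x5 + w x3 (b x1 x2 x4) x5 + w x3 x4 (b x1 x2 x5) =
    b x1 x2 (w x3 x4 x5) + w x1 x2 (b x3 x4 x5)).
Proof.
move=> bE; split=> E.
  move=> x1 x2 x3 x4 x5.
  have := E (tconst x1) (tconst x2) (tconst x3) (tconst x4) (tconst x5).
  rewrite !(text_tconstE w tb) => -[_ /= e].
  by rewrite [RHS]addrC e [RHS](AC (2*2*2) (2*4*6*1*3*5)%AC).
apply: quintilinear_tconst_eq; [by split; prove_linear..|].
move=> x1 x2 x3 x4 x5; rewrite !(text_tconstE w tb).
congr pair; first exact: bE.
by rewrite /= [LHS]addrC -E [LHS](ACl ((4*1)*(5*2)*(6*3))%AC).
Qed.

(** With [U], [V] the two algebras in either order, this and the next two equivalences each serve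
    twice; here they give [cocycle2_Z4] and [cocycle2_Z3]. *)
Lemma derivation_text :
    (forall a1 a2 x1 x2 x3,
       psi a1 a2 (b x1 x2 x3) =
       b (psi a1 a2 x1) x2 x3 + b x1 (psi a1 a2 x2) x3
       + b x1 x2 (psi a1 a2 x3)) ->
  (forall a1 a2 x1 x2 x3,
     psit a1 a2 (bt x1 x2 x3) =
     bt (psit a1 a2 x1) x2 x3 + bt x1 (psit a1 a2 x2) x3
     + bt x1 x2 (psit a1 a2 x3))
  <->
  (forall a1 a2 x1 x2 x3,
    psi a1 a2 (w x1 x2 x3) + phi a1 a2 (b x1 x2 x3) =
    b (phi a1 a2 x1) x2 x3 + b x1 (phi a1 a2 x2) x3
    + b x1 x2 (phi a1 a2 x3)
    + w (psi a1 a2 x1) x2 x3 + w x1 (psi a1 a2 x2) x3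
    + w x1 x2 (psi a1 a2 x3)).
Proof.
move=> bE; split=> E.
  move=> a1 a2 x1 x2 x3.
  have := E (tconst a1) (tconst a2) (tconst x1) (tconst x2) (tconst x3).
  rewrite !(text_tconstE w tb, text_tconstE phi tpsi) => -[_ /= e].
  by rewrite addrC e [LHS](AC (2*2*2) (2*4*6*1*3*5)%AC).
apply: quintilinear_tconst_eq; [by split; prove_linear..|].
move=> a1 a2 x1 x2 x3; rewrite !(text_tconstE w tb, text_tconstE phi tpsi).
congr pair; first exact: bE.
by rewrite /= [LHS]addrC E [LHS](ACl ((4*1)*(5*2)*(6*3))%AC).
Qed.

(** The exchange axiom carries leading minus signs, whereas the cocycle identity is its negative.
    Unprimed letters are terms with the outer map perturbed, primed ones those with the inner map
    perturbed. *)
Let opp_zmod (Z : zmodType) (a a' c c' d d' e e' : Z) :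
  - (a + a') = - (c + c') + (d + d') - (e + e') <->
  a' + a = c' + c - d' - d + e' + e.
Proof.
have -> : a' + a = - - (a + a') by rewrite opprK addrC.
have -> : c' + c - d' - d + e' + e = - (- (c + c') + (d + d') - (e + e')).
  by rewrite !opprD !opprK [LHS](ACl ((2*1)*(4*3)*(6*5))%AC).
by split=> [->|/oppr_inj].
Qed.

Lemma exchange_text :
    (forall a1 a2 x1 x2 x3,
       - psi (rho x1 x2 a1) a2 x3 =
       - psi (rho x1 x3 a2) a1 x2 + psi (rho x2 x3 a2) a1 x1
       - b x1 x2 (psi a1 a2 x3)) ->
  (forall a1 a2 x1 x2 x3,
     - psit (rhot x1 x2 a1) a2 x3 =
     - psit (rhot x1 x3 a2) a1 x2 + psit (rhot x2 x3 a2) a1 x1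
     - bt x1 x2 (psit a1 a2 x3))
  <->
  (forall x1 x2 x3 a1 a2,
    psi (nu x1 x2 a1) a2 x3 + phi (rho x1 x2 a1) a2 x3 =
    psi (nu x1 x3 a2) a1 x2 + phi (rho x1 x3 a2) a1 x2
    - psi (nu x2 x3 a2) a1 x1 - phi (rho x2 x3 a2) a1 x1
    + b x1 x2 (phi a1 a2 x3) + w x1 x2 (psi a1 a2 x3)).
Proof.
move=> bE; split=> E.
  move=> x1 x2 x3 a1 a2; apply/opp_zmod.
  have := E (tconst a1) (tconst a2) (tconst x1) (tconst x2) (tconst x3).
  by rewrite !tconstE => -[].
apply: quintilinear_tconst_eq; [by split; prove_linear..|].
move=> a1 a2 x1 x2 x3; rewrite !tconstE; congr pair; first exact: bE.
exact/opp_zmod/E.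
Qed.

Lemma compatibility_text :
    (forall a1 a2 x1 x2 x3,
       b (psi a1 a2 x1) x2 x3 =
       psi a1 a2 (b x1 x2 x3) + psi (rho x2 x3 a1) a2 x1
       + psi a1 (rho x2 x3 a2) x1) ->
  (forall a1 a2 x1 x2 x3,
     bt (psit a1 a2 x1) x2 x3 =
     psit a1 a2 (bt x1 x2 x3) + psit (rhot x2 x3 a1) a2 x1
     + psit a1 (rhot x2 x3 a2) x1)
  <->
  (forall a1 a2 x1 x2 x3,
    w (psi a1 a2 x1) x2 x3 + b (phi a1 a2 x1) x2 x3 =
    psi a1 a2 (w x1 x2 x3) + phi a1 a2 (b x1 x2 x3)
    + phi (rho x2 x3 a1) a2 x1 + psi (nu x2 x3 a1) a2 x1
    + phi a1 (rho x2 x3 a2) x1 + psi a1 (nu x2 x3 a2) x1).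
Proof.
move=> bE; split=> E.
  move=> a1 a2 x1 x2 x3.
  have := E (tconst a1) (tconst a2) (tconst x1) (tconst x2) (tconst x3).
  by rewrite !tconstE => -[_ /= ->];
    rewrite [LHS](AC (2*2*2) (2*1*3*4*5*6)%AC).
apply: quintilinear_tconst_eq; [by split; prove_linear..|].
move=> a1 a2 x1 x2 x3; rewrite !tconstE; congr pair; first exact: bE.
by rewrite /= E [LHS](ACl ((2*1)*(3*4)*(5*6))%AC).
Qed.

End FirstOrder.
End Extension.

(** * Maps of the form id + t f *)

Lemma id_plus_tE (R : comNzRingType) (V : lmodType R) (f : V -> V)
    (x : tmod V) : id_plus_t f x = (x.1, x.2 + f x.1).
Proof. by rewrite /id_plus_t tvar_scale; congr pair; rewrite /= addr0. Qed.

Lemma id_plus_t_linear (R : comNzRingType) (V : lmodType R)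
    (f : {linear V -> V}) : linear (id_plus_t f).
Proof.
move=> p x y; rewrite !id_plus_tE; congr pair => /=.
by rewrite linearP !scalerDr [LHS](AC (3*2) (1*4*2*(3*5))%AC).
Qed.

(** Constant terms agree, and in the coefficient of t the contributions of the t-parts of the
    arguments cancel. Separate [k] and [l] cover the two actions; the brackets take [k = l]. *)
Lemma id_plus_t_text (R : comNzRingType) (U V : lmodType R)
    (m n n' : U -> U -> V -> V) (k : U -> U) (l : V -> V) : trilinear m ->
  (forall x y z,
     id_plus_t l (text m n x y z) =
     text m n' (id_plus_t k x) (id_plus_t k y) (id_plus_t l z)) <->
  (forall x y z, n x y z - n' x y z =
     m (k x) y z + m x (k y) z + m x y (l z) - l (m x y z)).
Proof.
move=> tm; split=> E x y z.
  have := E (tconst x) (tconst y) (tconst z).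
  rewrite !id_plus_tE /text /= !add0r !(trilinear0 tm) !addr0 => -[e].
  by apply/eqP; rewrite subr_eq addrAC eq_sym subr_eq eq_sym e addrC.
rewrite !id_plus_tE /text /=; congr pair.
(* Writing [n] as [(n - n') + n'] lets [E] apply; its term [- l (m x y z)] then cancels the one
   produced by [id_plus_t l]. *)
rewrite !(trilinearE tm) -[n _ _ _](subrK (n' x.1 y.1 z.1)) E.
rewrite [LHS](AC (5*3*1) (5*(6*1)*(7*2)*(8*3)*(4*9))%AC) /= addNr addr0.
by rewrite -!addrA.
Qed.

(** * Deformations as cocycles, equivalence as cohomology *)

Section Deformation.
Variables (R : comNzRingType) (g h : lmodType R) (M : matched_pair g h).

Lemma deformation_cocycle (d : quadruple g h) :
  is_deformation M d <-> is_cocycle2 M d.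
Proof.
have [[lg lh [trho arho] [tpsi apsi]] [[m1 m2 m3] [m4 m5 m6]]] := mp_axioms M.
have [tbg abg fg] := lg; have [tbh abh fh] := lh.
split=> [[cd] | cd].
  have [[tw aw] [tth ath] [tnu anu] [tphi aphi]] := cd.
  case=> -[[_ _ d1] [_ _ d2] _ _] [[d3 d4 d5] [d6 d7 d8]].
  split; first exact: cd.
  - exact/(fundamental_identity_text tbg tw fg).
  - exact/(fundamental_identity_text tbh tth fh).
  - exact/(derivation_text tbh tth trho tnu m4).
  - exact/(derivation_text tbg tw tpsi tphi m1).
  - exact/(exchange_text tbg tw trho tnu tpsi tphi m2).
  - exact/(exchange_text tbh tth tpsi tphi trho tnu m5).
  - exact/(compatibility_text tbg tw trho tnu tpsi tphi m3).
  - exact/(compatibility_text tbh tth tpsi tphi trho tnu m6).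
case: cd => cd z1 z2 z3 z4 z5 z6 z7 z8.
have [[tw aw] [tth ath] [tnu anu] [tphi aphi]] := cd.
(* Trilinearity and alternation come from the cochain conditions, the remaining axioms from the
   cocycle identities. *)
split=> //; split.
  split.
  - split; [exact: text_trilinear|exact: text_alternating3|].
    exact/(fundamental_identity_text tbg tw fg).
  - split; [exact: text_trilinear|exact: text_alternating3|].
    exact/(fundamental_identity_text tbh tth fh).
  - by split; [exact: text_trilinear|exact: text_alternating12].
  - by split; [exact: text_trilinear|exact: text_alternating12].
split; split.
- exact/(derivation_text tbg tw tpsi tphi m1).
- exact/(exchange_text tbg tw trho tnu tpsi tphi m2).
- exact/(compatibility_text tbg tw trho tnu tpsi tphi m3).
- exact/(derivation_text tbh tth trho tnu m4).
- exact/(exchange_text tbh tth tpsi tphi trho tnu m5).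
- exact/(compatibility_text tbh tth tpsi tphi trho tnu m6).
Qed.

Lemma mp_morphism_D1 (d d' : quadruple g h)
    (f : {linear g -> g}) (u : {linear h -> h}) :
  mp_morphism (deformed M d) (deformed M d') (id_plus_t f) (id_plus_t u) <->
  d - d' = D1 M f u.
Proof.
have [[[tbg _ _] [tbh _ _] [trho _] [tpsi _]] _] := mp_axioms M.
have Eg := id_plus_t_text (q_ggg d) (q_ggg d') f f tbg.
have Eh := id_plus_t_text (q_hhh d) (q_hhh d') u u tbh.
have Er := id_plus_t_text (q_ggh d) (q_ggh d') f u trho.
have Ep := id_plus_t_text (q_hhg d) (q_hhg d') u f tpsi.
split=> [[[_ e1] [_ e2] e3 e4]|E].
  congr (_, _, _, _); apply/funext=> x; apply/funext=> y; apply/funext=> z.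
  - exact: (proj1 Eg e1).
  - exact: (proj1 Eh e2).
  (* For the actions, [D1] lists the terms with the last argument moved first. *)
  - by rewrite [RHS](ACl (3*4*1*2)%AC); exact: (proj1 Er e3).
  - by rewrite [RHS](ACl (3*4*1*2)%AC); exact: (proj1 Ep e4).
have E1 : q_ggg (d - d') = q_ggg (D1 M f u) by rewrite E.
have E2 : q_hhh (d - d') = q_hhh (D1 M f u) by rewrite E.
have E3 : q_ggh (d - d') = q_ggh (D1 M f u) by rewrite E.
have E4 : q_hhg (d - d') = q_hhg (D1 M f u) by rewrite E.
split.
- split; first exact: id_plus_t_linear.
  by apply/Eg => x y z; have := congr1 (fun F => F x y z) E1.
- split; first exact: id_plus_t_linear.
  by apply/Eh => x y z; have := congr1 (fun F => F x y z) E2.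
- apply/Er => x y z; have := congr1 (fun F => F x y z) E3.
  by rewrite [X in _ = X -> _](ACl (3*4*1*2)%AC).
- apply/Ep => x y z; have := congr1 (fun F => F x y z) E4.
  by rewrite [X in _ = X -> _](ACl (3*4*1*2)%AC).
Qed.

Lemma deformation_in_Z2 (d : deformation M) : val d \in Z2 M.
Proof. by apply/asboolP/deformation_cocycle/asboolP; exact: (valP d). Qed.

Lemma cocycle_is_deformation (c : cocycle2 M) : `[< is_deformation M (val c) >].
Proof. by apply/asboolP/deformation_cocycle/asboolP; exact: (valP c). Qed.

Definition cocycle_of_deformation (d : deformation M) : cocycle2 M :=
  Cocycle2 (deformation_in_Z2 d).

Definition deformation_of_cocycle (c : cocycle2 M) : deformation M :=
  exist _ (val c) (cocycle_is_deformation c).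

Lemma deformation_of_cocycleK :
  cancel deformation_of_cocycle cocycle_of_deformation.
Proof. by move=> c; exact: val_inj. Qed.

Local Open Scope quotient_scope.

(** Both congruences ask for a pair of linear maps, and [mp_morphism_D1] shows that the same pair
    serves for both. *)
Lemma deformation_equiv_cohomologous (d d' : deformation M) :
  (d == d' %[mod deformation_classes M]) =
  (cocycle_of_deformation d == cocycle_of_deformation d' %[mod H2 M]).
Proof.
rewrite eqmodE piE Quotient.equivE.
by apply/asboolP/asboolP=> -[f [u /mp_morphism_D1 e]]; exists f, u.
Qed.

End Deformation.

(** * Passage to the quotients *)

Theorem theorem4p2 (k : fieldType) (g h : lmodType k) (M : matched_pair g h) :
  exists F : deformation_classes M -> H2 M, bijective F.
Proof.
(* Both maps use chosen representatives; [deformation_equiv_cohomologous] makes the choices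
   harmless. *)
pose F (x : deformation_classes M) : H2 M :=
  \pi_(H2 M)%qT (cocycle_of_deformation (repr x)).
pose G (y : H2 M) : deformation_classes M :=
  \pi_(deformation_classes M)%qT (deformation_of_cocycle (repr y)).
exists F, G => [x|y].
  (* With [x] written as the class of [repr x], the goal is a congruence of deformations, which
     transfers to cocycles. *)
  rewrite -[RHS]reprK; apply/eqP.
  rewrite deformation_equiv_cohomologous deformation_of_cocycleK.
  by rewrite reprK.
rewrite -[RHS]reprK -[repr y in RHS]deformation_of_cocycleK; apply/eqP.
by rewrite -deformation_equiv_cohomologous reprK.
Qed.
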